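(* Let $n\ge 2w\ge 2$ and $e\ge 1$ be integers and put $\bar\omega=n-w$. Assume that $\mathcal C$ is a nontrivial $e$-perfect code in $J(n,w)$ with strength redundancy $d$. Then $$\Phi_e(n,w)\ \Big|\ \gcd_{d\le k\le\bar\omega}\binom{\bar\omega+d}{k}.$$
   Context: The Johnson scheme $J(n,w)$ has as elements all $w$-subsets of $[n]=\{1,\dots,n\}$, with distance $d(X,Y)=|X\setminus Y|$. The $e$-ball centred at $X$ is the set of $w$-subsets at distance at most $e$ from $X$; its size is $\Phi_e(n,w)=\sum_{i=0}^{e}\binom{w}{i}\binom{n-w}{i}$. An $e$-perfect code in $J(n,w)$ is a set $\mathcal C$ of $w$-subsets such that the $e$-balls centred at the elements of $\mathcal C$ partition the set of all $w$-subsets of $[n]$. It is trivial if $e=0$, or $|\mathcal C|=1$, or $n=2w$, $w=2e+1$ and $\mathcal C$ consists of a $w$-subset and its complement; otherwise it is nontrivial. A set $\mathcal C$ of $w$-subsets of $[n]$ is a $t$-design if there is $\lambda$ such that every $t$-subset of $[n]$ is contained in exactly $\lambda$ elements of $\mathcal C$. The strength $\varphi$ of $\mathcal C$ is the largest $t\le w$ for which $\mathcal C$ is a $t$-design, and the strength redundancy is $d=w-\varphi$. The gcd is over all integers $k$ with $d\le k\le\bar\omega$. *)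

(* Defs.v *)
(* MathComp. The ground set [n] = {1, ..., n} is the type 'I_n. *)
From mathcomp Require Import all_boot.

Set Implicit Arguments.
Unset Strict Implicit.
Unset Printing Implicit Defensive.

Definition wsubsets (n w : nat) : {set {set 'I_n}} :=
  [set X : {set 'I_n} | #|X| == w].

Definition johnson_dist (n : nat) (X Y : {set 'I_n}) : nat := #|X :\: Y|.

Definition johnson_ball (n w e : nat) (X : {set 'I_n}) : {set {set 'I_n}} :=
  [set Y in wsubsets n w | johnson_dist X Y <= e].

Definition Phi (e n w : nat) : nat :=
  \sum_(0 <= i < e.+1) 'C(w, i) * 'C(n - w, i).

(* The balls partition the w-subsets as a family indexed by C. The injectivity
   clause is needed because [partition] only sees the set of balls, in which
   two centres with the same ball would be identified. *)
Definition perfect_code (n w e : nat) (C : {set {set 'I_n}}) : Prop :=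
  [/\ C \subset wsubsets n w,
      {in C &, injective (johnson_ball w e)} &
      partition [set johnson_ball w e X | X in C] (wsubsets n w)].

Definition trivial_code (n w e : nat) (C : {set {set 'I_n}}) : Prop :=
  [\/ e = 0,
      #|C| = 1 |
      [/\ n = 2 * w, w = 2 * e + 1 &
          exists2 X : {set 'I_n}, X \in wsubsets n w & C = [set X; ~: X]]].

Definition is_design (n t : nat) (C : {set {set 'I_n}}) : Prop :=
  exists lambda : nat, forall T : {set 'I_n},
    #|T| = t -> #|[set X in C | T \subset X]| = lambda.

Definition is_strength (n w : nat) (C : {set {set 'I_n}}) (phi : nat) : Prop :=
  [/\ phi <= w, is_design phi C &
      forall t : nat, t <= w -> is_design t C -> t <= phi].

Definition is_strength_redundancy (n w : nat) (C : {set {set 'I_n}})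
    (d : nat) : Prop :=
  exists2 phi : nat, is_strength w C phi & d = w - phi.

(* Main.v *)
Require Import Defs.
From mathcomp Require Import all_boot all_order all_algebra.
From mathcomp Require Import zify.

(** Write [m = n - w] and [a = n - 2w].  The integer-valued function
    [h X = Phi * (X \in C) - 1] on the [w]-subsets measures how far [C] is from
    being uniform, and perfectness of [C] says exactly that [h] sums to zero
    over every [e]-ball.  Design properties of [C] are statements about the sums
    of [h] over the sets [X] with a prescribed trace [X :&: T = S].

    If those sums vanish for every [T] of size [t], then [Phi] times the number
    of codewords with trace [S] on [T] is the number of all [w]-subsets with
    that trace, namely ['C(n - t, w - #|S|)].  Vanishing up to level [t] is
    equivalent to [C] being a [t]-design ([traces_vanish_design] and
    [design_traces_vanish]), so at the strength [phi = w - d] every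
    ['C(m + d, k)] with [d <= k <= w] is divisible by [Phi].  The symmetry of
    binomial coefficients turns this range into [m + d - w <= k <= m], and the
    two ranges together cover [d <= k <= m] as soon as [phi >= a - 1].

    It remains to see that [C] is an [(a-1)]-design (when [a > 0]).  For a
    [t]-set [T], add up the ball relations centred at all [w]-subsets [Y]
    disjoint from [T].  If the levels below [t] vanish, the result reads
    [D_t * M(T) = 0], where [M(T)] is the sum of [h] over the sets disjoint from
    [T] and [D_t] is an eigenvalue of the ball in the Johnson scheme, written
    as a sum over the radii [i <= e] of alternating sums of products of binomial
    coefficients.  For [t < a] the terms of each alternating sum decrease in
    absolute value ([sphere_term_decr]), hence [D_t > 0] and [M(T) = 0], which
    gives vanishing at level [t] ([traces_vanish_small]).

    The decrease rests on Roos' bound [e * a + 2e + 1 <= w] for a perfect code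
    with at least two words ([Roos_bound]), and this is where nontriviality
    enters.  The bound is proved locally: given a codeword [X], a set [R] of
    [e + 1] points of [X] and a set [S] of [e] points outside [X], the codewords
    at distance [2e + 1] from [X] that avoid [R] and contain [S] cover the
    points outside [X :|: S] in groups of [e + 1], while they miss pairwise
    disjoint [e]-subsets of [X :\: R]. *)

Set Implicit Arguments.
Unset Strict Implicit.
Unset Printing Implicit Defensive.

Import Order.TTheory GRing.Theory Num.Theory.

(** * Counting subsets *)

Section Counting.
Variable T : finType.
Implicit Types A B Z : {set T}.

Lemma card_setD_sym A B : #|A| = #|B| -> #|A :\: B| = #|B :\: A|.
Proof.
by move=> eqAB; have := cardsID A B; have := cardsID B A; rewrite setIC; lia.
Qed.

Lemma setI_eqr A B : (A :&: B == B) = (B \subset A).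
Proof. by rewrite (sameP eqP setIidPr). Qed.

Lemma exists_subset_card A k : k <= #|A| ->
  exists2 B : {set T}, B \subset A & #|B| = k.
Proof.
move=> lek; have : 0 < #|[set B : {set T} | B \subset A & #|B| == k]|.
  by rewrite cards_draws bin_gt0.
by case/card_gt0P => B; rewrite inE => /andP[sB /eqP cB]; exists B.
Qed.

(** Such a [Z] is the disjoint union of its independent parts in [A] and [B]. *)
Lemma card_split_draws A B i k : [disjoint A & B] ->
  #|[set Z : {set T} | [&& Z \subset A :|: B, #|Z :&: A| == i &
                        #|Z :&: B| == k]]| = 'C(#|A|, i) * 'C(#|B|, k).
Proof.
move=> dAB; have AB0 : A :&: B = set0 by apply/eqP; rewrite setI_eq0.
rewrite -!cards_draws -cardsX.
set D := setX _ _.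
have DP (p : {set T} * {set T}) : p \in D ->
    (p.1 :|: p.2) :&: A = p.1 /\ (p.1 :|: p.2) :&: B = p.2.
  case: p => P Q /=; rewrite in_setX !inE.
  move=> /andP[/andP[/setIidPl s1 _] /andP[/setIidPl s2 _]].
  have QA : Q :&: A = set0 by rewrite -s2 -setIA (setIC B) AB0 setI0.
  have PB : P :&: B = set0 by rewrite -s1 -setIA AB0 setI0.
  by rewrite !setIUl s1 s2 QA PB setU0 set0U.
rewrite -(card_in_imset (f := fun p => p.1 :|: p.2) (D := mem D)); last first.
  move=> p q pD qD eq_pq; have [p1 p2] := DP p pD; have [q1 q2] := DP q qD.
  apply: injective_projections; first by rewrite -p1 -q1 eq_pq.
  by rewrite -p2 -q2 eq_pq.
apply: eq_card => Z; rewrite inE; apply/and3P/imsetP => [[sZ zA zB]|[p pD ->]].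
  exists (Z :&: A, Z :&: B); last by rewrite /= -setIUr; apply/esym/setIidPl.
  by rewrite in_setX !inE !subsetIr zA zB.
have [p1 p2] := DP p pD; rewrite p1 p2.
case: p pD {p1 p2} => P Q /=; rewrite in_setX !inE.
move=> /andP[/andP[s1 c1] /andP[s2 c2]].
by split=> //; apply: setUSS.
Qed.

Lemma sum_subsets_card (R : nmodType) (A : {set T}) (F : nat -> R) :
  (\sum_(S : {set T} | S \subset A) F #|S| =
   \sum_(s < #|A|.+1) F s *+ 'C(#|A|, s))%R.
Proof.
rewrite (partition_big (fun S : {set T} => inord #|S| : 'I_#|A|.+1) xpredT) //=.
apply: eq_bigr => s _; rewrite -cards_draws -sumr_const.
have eqs (S : {set T}) : S \subset A -> (inord #|S| == s) = (#|S| == s).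
  by move=> sS; rewrite -val_eqE /= inordK // ltnS subset_leq_card.
under [RHS]eq_bigl => S do rewrite inE.
apply: eq_big => [S|S /andP[sS]]; last by rewrite eqs // => /eqP->.
by case sS: (S \subset A); rewrite //= eqs.
Qed.

Lemma card_le_fibers (P : pred T) (f : T -> nat) e :
  #|[set x | P x & f x <= e]| = \sum_(i < e.+1) #|[set x | P x & f x == i]|.
Proof.
rewrite -sum1_card (partition_big (fun x => inord (f x) : 'I_e.+1) xpredT) //=.
apply: eq_bigr => i _; rewrite -sum1_card; apply: eq_bigl => x.
rewrite !inE -andbA; congr (_ && _); rewrite -val_eqE /=.
case: (leqP (f x) e) => [le_fe|lt_ef]; first by rewrite inordK.
by apply/esym/eqP => fi; have := ltn_ord i; rewrite -fi ltnS leqNgt lt_ef.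
Qed.
End Counting.

Section JohnsonCounting.
Variables n w : nat.
Implicit Types X Y S T : {set 'I_n}.
Local Notation V := (wsubsets n w).

Lemma johnson_distC X Y : X \in V -> Y \in V ->
  johnson_dist X Y = johnson_dist Y X.
Proof.
by rewrite !inE => /eqP cX /eqP cY; apply: card_setD_sym; rewrite cX cY.
Qed.

Lemma card_wsubsets_trace S T : S \subset T -> #|S| <= w ->
  #|[set X in V | X :&: T == S]| = 'C(n - #|T|, w - #|S|).
Proof.
move=> sST le_Sw.
have dTS : [disjoint ~: T & S] by rewrite disjoint_sym -subsets_disjoint.
transitivity ('C(#|~: T|, w - #|S|) * 'C(#|S|, #|S|)); last first.
  by rewrite binn muln1 cardsCs setCK card_ord.
(* [S \subset X] is encoded by [X] meeting [S] in [#|S|] points. *)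
rewrite -card_split_draws //; apply: eq_card => X; rewrite !inE.
apply/andP/and3P => [[/eqP cX /eqP XT]|[sX /eqP cXT /eqP cXS]].
  have XS : X :&: S = S by rewrite -XT setIA setIid.
  have := cardsID T X; rewrite XT setDE cX => cXT; split.
  - by apply/subsetP => x xX; rewrite -XT !inE xX; case: (x \in T).
  - by apply/eqP; lia.
  - by rewrite XS.
have sSX : S \subset X.
  by apply/setIidPr/eqP; rewrite eqEcard subsetIr cXS leqnn.
have XT : X :&: T = S.
  apply/eqP; rewrite eqEsubset subsetI sSX sST !andbT.
  apply/subsetP => x; rewrite inE => /andP[xX xT].
  by have := subsetP sX x xX; rewrite !inE xT.
split; apply/eqP => //.
by have := cardsID T X; rewrite XT setDE cXT; lia.
Qed.

(** A set [Y] disjoint from [T] is determined by its [w - i] points in [X :\: T]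
    and its [i] points outside [X :|: T].  The count depends on [X] only through
    [#|X :&: T|], which is what makes ball sums computable from traces. *)
Lemma card_johnson_sphere_avoiding X T i : X \in V -> #|T| <= n - w -> i <= w ->
  #|[set Y in V | (Y :&: T == set0) && (johnson_dist X Y == i)]|
  = 'C(w - #|X :&: T|, w - i) * 'C(n - w - #|T| + #|X :&: T|, i).
Proof.
rewrite inE => /eqP cX le_T le_iw.
have dXT : [disjoint X :\: T & ~: (X :|: T)].
  rewrite -setI_eq0; apply/eqP/setP => x; rewrite !inE negb_or.
  by case: (x \in X); rewrite ?andbF.
have cA : #|X :\: T| = w - #|X :&: T| by rewrite cardsD cX.
have cB : #|~: (X :|: T)| = n - w - #|T| + #|X :&: T|.
  have := cardsUI X T; have := cardsC (X :|: T); rewrite card_ord.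
  have := subset_leq_card (subsetIr X T); lia.
rewrite -cA -cB -card_split_draws //; apply: eq_card => Y; rewrite !inE.
have YA : Y :&: T = set0 -> Y :&: (X :\: T) = Y :&: X.
  move=> YT; apply/setP => x; move/setP/(_ x): YT; rewrite !inE.
  by case: (x \in Y); case: (x \in T).
have YB : Y :&: T = set0 -> Y :&: ~: (X :|: T) = Y :\: X.
  move=> YT; apply/setP => x; move/setP/(_ x): YT; rewrite !inE.
  by case: (x \in Y); case: (x \in T); case: (x \in X).
have YT_sub : (Y :&: T == set0) = (Y \subset X :\: T :|: ~: (X :|: T)).
  rewrite setI_eq0 disjoints_subset.
  suff -> : X :\: T :|: ~: (X :|: T) = ~: T by [].
  by apply/setP => x; rewrite !inE; case: (x \in X); case: (x \in T).
have cXY := cardsID Y X; have cYX := cardsID X Y; rewrite setIC in cYX.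
rewrite /johnson_dist -YT_sub.
case YT: (Y :&: T == set0); last by rewrite andbF.
rewrite YA ?YB; try exact/eqP.
rewrite [Y :&: X]setIC.
by apply/andP/andP => -[/eqP ? /eqP ?]; split; apply/eqP; lia.
Qed.
End JohnsonCounting.

(** * Alternating sums with decreasing terms *)

Lemma alternating_sum_bounds (b : nat -> int) k :
    (forall s, 0 <= b s)%R -> (forall s, s.+1 < k -> (b s.+1 <= b s)%R) ->
  (0 <= \sum_(s < k) (-1) ^+ s * b s <= b 0)%R.
Proof.
elim: k b => [|k IHk] b b_ge0 b_dec; first by rewrite big_ord0 lexx b_ge0.
rewrite big_ord_recl /= expr0 mul1r.
under eq_bigr => s _ do rewrite /bump /= add1n exprS mulN1r mulNr.
rewrite sumrN.
have /andP[ge0 le1] := IHk (fun s => b s.+1) (fun s => b_ge0 s.+1)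
  (fun s ltsk => b_dec s.+1 ltsk).
rewrite /= in ge0 le1.
case: k IHk b_dec ge0 le1 => [|k] IHk b_dec ge0 le1.
  by rewrite big_ord0 subr0 lexx b_ge0.
have b10 : (b 1 <= b 0)%R := b_dec 0 isT.
apply/andP; split; first by rewrite subr_ge0 (le_trans le1).
by rewrite lerBlDr lerDl.
Qed.

(** Strictness is asked for only where the terms are positive, since the terms
    used below are eventually zero. *)
Lemma alternating_sum_gt0 (b : nat -> nat) t :
    0 < b 0 ->
    (forall s, s < t -> b s.+1 <= b s /\ (0 < b s -> b s.+1 < b s)) ->
  (0 < \sum_(s < t.+1) (-1) ^+ s * (b s)%:Z)%R.
Proof.
move=> b0 b_dec; rewrite big_ord_recl /= expr0 mul1r.
under eq_bigr => s _ do rewrite /bump /= add1n exprS mulN1r mulNr.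
rewrite sumrN.
have /andP[_ le1] : (0 <= \sum_(s < t) (-1) ^+ s * (b s.+1)%:Z <= (b 1)%:Z)%R.
  apply: (@alternating_sum_bounds (fun s => Posz (b s.+1))) => // s ltst.
  by have [] := b_dec s.+1 ltst.
case: t b_dec le1 => [|t] b_dec le1; first by rewrite big_ord0; lia.
have [_ /(_ b0) b10] := b_dec 0 isT.
by rewrite subr_gt0 (le_lt_trans le1) // ltz_nat.
Qed.

Lemma eq_mul_ltn_coef (K k x y : nat) : K * y = k * x -> k < K ->
  y <= x /\ (0 < x -> y < x).
Proof.
move=> eqKk ltkK; have K0 : 0 < K by apply: leq_ltn_trans ltkK.
split=> [|x0]; last by rewrite -(ltn_pmul2l K0) eqKk ltn_pmul2r.
by rewrite -(leq_pmul2l K0) eqKk leq_mul2r (ltnW ltkK) orbT.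
Qed.

(** With [m = n - w]: the number of [s]-subsets [S] of a [t]-set [T], times the
    number of [w]-subsets disjoint from [T] at distance [i] from a [w]-subset
    whose trace on [T] is [S] ([card_johnson_sphere_avoiding]).  The alternating
    sum over [s] is the [t]-th eigenvalue of the distance-[i] relation. *)
Definition sphere_term w m t i s :=
  'C(t, s) * ('C(w - s, w - i) * 'C(m - t + s, i)).

(** The ratio of consecutive terms, cleared of denominators; each binomial
    factor contributes one factor on either side. *)
Lemma sphere_term_rec w m t i s : s < t -> i <= w -> t <= w ->
  s.+1 * ((w - s) * ((m - t + s).+1 - i)) * sphere_term w m t i s.+1
  = (t - s) * ((i - s) * (m - t + s).+1) * sphere_term w m t i s.
Proof.
move=> lt_st le_iw le_tw; rewrite /sphere_term addnS.
rewrite [LHS]mulnACA [X in _ * X = _]mulnACA.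
rewrite [RHS]mulnACA [X in _ = _ * X]mulnACA.
congr (_ * (_ * _)).
- exact: mul_bin_left.
- rewrite subnS mul_bin_down; congr (_ * _); lia.
- by rewrite -mul_bin_down.
Qed.

(** With [q = e (t - s)] and [M = m - t + s + 1], the left side is at most [q M].
    Since [t < a], the bound [roos] gives [w - s >= q + 3e + 1], and also
    [w - s < M]; the surplus [(3e + 1) M] then outweighs the loss from
    replacing [M] by [M - i]. *)
Lemma sphere_coef_lt w m t e a i s :
    0 < e -> i <= e -> e * a + (2 * e).+1 <= w -> m = w + a -> t < a -> s < t ->
  (t - s) * ((i - s) * (m - t + s).+1)
  < s.+1 * ((w - s) * ((m - t + s).+1 - i)).
Proof.
move=> e_gt0 le_ie roos ma lt_ta lt_st.
set M := (m - t + s).+1; pose q := e * (t - s).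
have le_est : e * t.+1 <= e * a by rewrite leq_mul2l lt_ta orbT.
have le_s : s <= e * s by rewrite leq_pmull.
have h1 : q + (3 * e).+1 <= w - s.
  by rewrite /q mulnBr; rewrite mulnS in le_est; lia.
have h2 : w - s < M by rewrite /M; lia.
have h3 : (t - s) * ((i - s) * M) <= q * M.
  by rewrite mulnA leq_mul2r /q mulnC leq_mul ?orbT //; lia.
apply: (leq_ltn_trans h3).
apply: (@leq_trans ((w - s) * (M - i))); last by rewrite leq_pmull.
apply: (@leq_trans ((q + (3 * e).+1) * (M - e))); last first.
  by rewrite leq_mul //; lia.
have [N dM] : exists N, M = e + N by exists (M - e); lia.
have qN : q < N by lia.
rewrite dM addKn mulnDr mulnDl addnC ltn_add2l.
apply: (@leq_trans (N * e).+1).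
  by rewrite ltnS leq_mul2r (ltnW qN) orbT.
by rewrite mulnC ltn_pmul2r; lia.
Qed.

Lemma sphere_term_decr w m t e a i s :
    0 < e -> i <= e -> e * a + (2 * e).+1 <= w -> m = w + a -> t < a -> s < t ->
  sphere_term w m t i s.+1 <= sphere_term w m t i s /\
  (0 < sphere_term w m t i s ->
   sphere_term w m t i s.+1 < sphere_term w m t i s).
Proof.
move=> e0 ie roos ma ta st.
apply: eq_mul_ltn_coef (sphere_coef_lt e0 ie roos ma ta st).
have ea : a <= e * a by rewrite leq_pmull.
by apply: sphere_term_rec => //; lia.
Qed.

(** * Sums over prescribed traces *)

Section TraceSums.
Variables (n w : nat) (h : {set 'I_n} -> int).
Implicit Types X Y S T : {set 'I_n}.
Local Notation V := (wsubsets n w).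
Local Open Scope ring_scope.

Definition trace_sum T S : int := \sum_(X in V | X :&: T == S) h X.
Definition traces_vanish t := forall T S, (#|T| <= t)%N -> trace_sum T S = 0.

Lemma trace_sum_split T S x : x \in T -> x \notin S ->
  trace_sum (T :\ x) S = trace_sum T S + trace_sum T (x |: S).
Proof.
move=> xT xS; rewrite /trace_sum (bigID (fun X => x \notin X)) /=.
congr (_ + _); apply: eq_bigl => X; rewrite -andbA setIDA; congr (_ && _).
  have xXT : (x \in X :&: T) = (x \in X) by rewrite inE xT andbT.
  have [xX|xX] := boolP (x \in X); rewrite ?andbF ?andbT /=.
    by apply/esym/eqP => defS; rewrite -defS xXT xX in xS.
  by rewrite (setDidPl _) // disjoint_sym disjoints1 xXT.
have xXT : (x \in X :&: T) = (x \in X) by rewrite inE xT andbT.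
have [xX|xX] := boolP (x \in X); rewrite ?andbF ?andbT /=.
  apply/eqP/eqP => [<-|->]; first by rewrite setD1K // xXT.
  by rewrite setU1K.
by apply/esym/eqP => defS; rewrite -xXT defS setU11 in xX.
Qed.

(** Moving a point of [T] into the trace flips the sign: the two sums add up to
    a sum over traces on the smaller set [T :\ x], which vanishes. *)
Lemma trace_sum_alternates t T S :
    traces_vanish t -> #|T| = t.+1 -> S \subset T ->
  trace_sum T S = (-1) ^+ #|S| * trace_sum T set0.
Proof.
move=> vt cT; move Dk: #|S| => k; elim: k S Dk => [|k IHk] S cS sST.
  by move/eqP: cS; rewrite cards_eq0 => /eqP->; rewrite mul1r.
have /card_gt0P[x xS] : (0 < #|S|)%N by rewrite cS.
have xT := subsetP sST x xS.
have := @trace_sum_split T (S :\ x) x xT; rewrite setD11 setD1K // => /(_ isT).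
rewrite vt; last by move: cT; rewrite (cardsD1 x) xT; lia.
rewrite IHk; last 2 first.
- by move: cS; rewrite (cardsD1 x) xS; lia.
- exact: subset_trans (subD1set _ _) sST.
by move/esym/eqP; rewrite addr_eq0 exprS mulN1r mulNr => /eqP->; rewrite opprK.
Qed.

Lemma trace_sum_notsub T S : ~~ (S \subset T) -> trace_sum T S = 0.
Proof.
move=> nST; apply: big_pred0 => X; apply/negP => /andP[_ /eqP defS].
by rewrite -defS subsetIr in nST.
Qed.

Lemma traces_vanishS t : traces_vanish t ->
  (forall T, #|T| = t.+1 -> trace_sum T set0 = 0) -> traces_vanish t.+1.
Proof.
move=> vt h0 T S; rewrite leq_eqVlt ltnS => /predU1P[cT|]; last exact: vt.
have [sST|/trace_sum_notsub//] := boolP (S \subset T).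
by rewrite (trace_sum_alternates vt cT sST) h0 // mulr0.
Qed.

Lemma sum_by_trace T (F : nat -> int) :
  \sum_(X in V) h X * F #|X :&: T| =
  \sum_(S : {set 'I_n} | S \subset T) trace_sum T S * F #|S|.
Proof.
rewrite (partition_big (fun X => X :&: T) (fun S : {set 'I_n} => S \subset T));
  last by move=> X _; apply: subsetIr.
apply: eq_bigr => S sST; rewrite mulr_suml.
by apply: eq_bigr => X /andP[_ /eqP->].
Qed.

Lemma sum_trace_setU1 T :
  \sum_(x | x \notin T) trace_sum (x |: T) (x |: T) =
  trace_sum T T *+ (w - #|T|).
Proof.
rewrite /trace_sum (exchange_big_dep (fun X => (X \in V) && (X :&: T == T))) /=.
  rewrite -sumrMnl; apply: eq_bigr => X /andP[XV /eqP/setIidPr sTX].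
  rewrite sumr_const; congr (_ *+ _).
  transitivity #|X :\: T|.
    apply: eq_card => x; rewrite [RHS]inE [LHS]unfold_in XV /= setI_eqr.
    by rewrite subUset sub1set sTX andbT.
  by move: XV; rewrite inE cardsD (setIidPr sTX) => /eqP->.
move=> x X _ /andP[-> /eqP/setIidPr]; rewrite subUset => /andP[_ /setIidPr->].
by rewrite eqxx.
Qed.

(** If the sums of [h] over the [w]-subsets containing a [t]-set do not depend on
    that set, they are zero when the total sum of [h] is: averaging over the
    [t]-sets containing a [(t-1)]-set carries the independence down to level 0,
    and the vanishing back up. *)
Lemma traces_vanish_const t : (t <= w <= n)%N -> traces_vanish 0 ->
  (forall T T', #|T| = t -> #|T'| = t -> trace_sum T T = trace_sum T' T') ->
  traces_vanish t.
Proof.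
case/andP=> le_tw le_wn v0; elim: t le_tw => [//|t IHt] lt_tw const.
have step T T' : #|T| = t -> #|T'| = t.+1 ->
    trace_sum T T *+ (w - t) = trace_sum T' T' *+ (n - t).
  move=> cT cT'; rewrite -cT -sum_trace_setU1.
  rewrite (eq_bigr (fun=> trace_sum T' T')) => [|x xT].
    have <- : #|~: T| = (n - #|T|)%N by rewrite cardsCs setCK card_ord.
    by rewrite -sumr_const; apply: eq_bigl => x; rewrite inE.
  by apply: const => //; rewrite cardsU1 xT cT.
have [|T0 _ cT0] := @exists_subset_card _ [set: 'I_n] t.+1.
  by rewrite cardsT card_ord; lia.
have wt_neq0 : (w - t == 0)%N = false by lia.
have nt_neq0 : (n - t == 0)%N = false by lia.
have vt : traces_vanish t.
  apply: IHt => [|T T' cT cT']; first exact: ltnW.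
  apply/eqP; rewrite -subr_eq0 -[_ == 0]orFb -wt_neq0 -mulrn_eq0 mulrnBl.
  by rewrite (step T T0) // (step T' T0) // subrr.
apply: traces_vanishS => // T cT.
have [|T1 _ cT1] := @exists_subset_card _ [set: 'I_n] t.
  by rewrite cardsT card_ord; lia.
have /eqP := step T1 T cT1 cT.
rewrite vt ?cT1 // mul0rn eq_sym mulrn_eq0 nt_neq0 /=.
by rewrite (trace_sum_alternates vt cT (subxx T)) mulf_eq0 signr_eq0 => /eqP.
Qed.

Variable e : nat.
Hypothesis ball_sum0 :
  forall Y, Y \in V -> \sum_(X in V | (johnson_dist X Y <= e)%N) h X = 0.

(** Add the ball relations of all [Y] disjoint from [T] and exchange the sums. *)
Lemma ball_sum_avoiding T : (#|T| <= n - w)%N -> (e <= w)%N ->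
  \sum_(X in V) h X *
    (\sum_(i < e.+1) 'C(w - #|X :&: T|, w - i) *
                     'C(n - w - #|T| + #|X :&: T|, i))%N%:Z = 0.
Proof.
move=> le_T le_ew.
transitivity (\sum_(Y in V | Y :&: T == set0)
                \sum_(X in V | (johnson_dist X Y <= e)%N) h X); last first.
  by apply: big1 => Y /andP[YV _]; apply: ball_sum0.
apply/esym.
rewrite (exchange_big_dep (mem V)) /=; last by move=> ? ? _ /andP[].
apply: eq_bigr => X XV.
rewrite sumr_const -mulr_natr natz; congr (_ * Posz _).
transitivity
  #|[set Y | (Y \in V) && (Y :&: T == set0) & johnson_dist X Y <= e]|%N.
  by apply: eq_card => Y; rewrite [RHS]inE unfold_in XV.
rewrite card_le_fibers; apply: eq_bigr => i _.
rewrite -card_johnson_sphere_avoiding //; last by have := ltn_ord i; lia.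
by apply: eq_card => Y; rewrite !inE -andbA.
Qed.

(** At each level [u] the relation [ball_sum_avoiding] becomes, by the alternation
    of trace sums, a multiple of [trace_sum T set0] whose coefficient is
    positive: for each radius [i <= e] it is an alternating sum with decreasing
    terms. *)
Lemma traces_vanish_small t : (0 < e)%N -> (2 * w <= n)%N ->
  (e * (n - 2 * w) + (2 * e).+1 <= w)%N -> (t <= (n - 2 * w).-1)%N ->
  traces_vanish t.
Proof.
move=> e0 le_n roos.
have vanish_level u : (u <= (n - 2 * w).-1)%N ->
    (forall T, #|T| = u -> forall S, S \subset T ->
        trace_sum T S = (-1) ^+ #|S| * trace_sum T set0) ->
    forall T, #|T| = u -> trace_sum T set0 = 0.
  move=> le_u alt T cT.
  have le_ew : (e <= w)%N.
    by apply: leq_trans (leq_trans (leq_addl _ _) roos); lia.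
  have le_aew : (n - 2 * w <= e * (n - 2 * w))%N by rewrite leq_pmull.
  (* The [Y] disjoint from [T] in the ball around a set meeting it [s] times. *)
  pose c s := (\sum_(i < e.+1) 'C(w - s, w - i) * 'C(n - w - u + s, i))%N.
  have := @ball_sum_avoiding T; rewrite cT => /(_ ltac:(lia) le_ew).
  rewrite (sum_by_trace T (fun s => (c s)%:Z)).
  under eq_bigr => S sST do rewrite (alt T cT S sST) mulrAC.
  rewrite -mulr_suml => /eqP; rewrite mulf_eq0 => /orP[|/eqP//].
  rewrite (sum_subsets_card T (fun s => (-1) ^+ s * (c s)%:Z)) cT.
  suff : 0 < \sum_(s < u.+1) ((-1) ^+ s * (c s)%:Z) *+ 'C(u, s) by case: ltrgtP.
  have -> : \sum_(s < u.+1) ((-1) ^+ s * (c s)%:Z) *+ 'C(u, s) =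
      \sum_(i < e.+1)
        \sum_(s < u.+1) (-1) ^+ s * (sphere_term w (n - w) u i s)%:Z.
    rewrite exchange_big; apply: eq_bigr => s _ /=; rewrite -mulr_sumr -mulrnAr.
    congr (_ * _); rewrite -mulr_natl natz -PoszM big_distrr /=.
    by rewrite (big_morph Posz PoszD (erefl _)).
  have term_sum_gt0 (i : 'I_e.+1) :
      0 < \sum_(s < u.+1) (-1) ^+ s * (sphere_term w (n - w) u i s)%:Z.
    have le_ie : (i <= e)%N by rewrite -ltnS.
    apply: (@alternating_sum_gt0 (sphere_term w (n - w) u i)) => [|s lt_su].
      by rewrite /sphere_term bin0 mul1n muln_gt0 !bin_gt0; lia.
    by apply: (@sphere_term_decr w (n - w) u e (n - 2 * w)) => //; lia.
  rewrite (bigD1 ord0) //=; apply: ltr_pwDl; first exact: (term_sum_gt0 ord0).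
  apply: sumr_ge0 => i _; exact: ltW (term_sum_gt0 i).
elim: t => [|t IHt] le_t.
  move=> T S; rewrite leqn0 cards_eq0 => /eqP->.
  have [|/trace_sum_notsub//] := boolP (S \subset set0).
  rewrite subset0 => /eqP->; apply: (vanish_level 0%N) => //; last first.
    exact: cards0.
  move=> T' /eqP; rewrite cards_eq0 => /eqP-> S'; rewrite subset0 => /eqP->.
  by rewrite cards0 mul1r.
apply: traces_vanishS; first by apply: IHt; lia.
apply: (vanish_level t.+1) => // T cT S sST.
by apply: trace_sum_alternates cT sST; apply: IHt; lia.
Qed.
End TraceSums.

(** * Perfect codes and Roos' bound *)

Section PerfectCodes.
Variables (n w e : nat) (C : {set {set 'I_n}}).
Implicit Types X Y S T : {set 'I_n}.
Local Notation V := (wsubsets n w).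
Hypothesis perfC : perfect_code w e C.

Lemma perfect_code_cover Y : Y \in V ->
  exists2 c, c \in C & johnson_dist c Y <= e.
Proof.
have [_ _ /and3P[/eqP covC _ _]] := perfC.
rewrite -covC => /bigcupP[_ /imsetP[c cC ->]].
by rewrite inE => /andP[_ ?]; exists c.
Qed.

Lemma perfect_code_uniq Y c1 c2 : Y \in V ->
  c1 \in C -> c2 \in C -> johnson_dist c1 Y <= e -> johnson_dist c2 Y <= e ->
  c1 = c2.
Proof.
have [_ inj_ball /and3P[_ triv _]] := perfC.
move=> YV c1C c2C d1 d2; apply: inj_ball => //.
have blk c : c \in C -> johnson_dist c Y <= e ->
    pblock [set johnson_ball w e X | X in C] Y = johnson_ball w e c.
  by move=> cC dc; apply: def_pblock; rewrite ?imset_f // inE YV.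
by rewrite -!blk.
Qed.

Lemma code_wsubset c : c \in C -> #|c| = w.
Proof. by case: perfC => /subsetP sC _ _ /sC; rewrite inE => /eqP. Qed.

Lemma perfect_code_neq0 : w <= n -> C != set0.
Proof.
move=> le_wn; have [|Y _ cY] := @exists_subset_card _ [set: 'I_n] w.
  by rewrite cardsT card_ord.
have [c cC _] : exists2 c, c \in C & johnson_dist c Y <= e.
  by apply: perfect_code_cover; rewrite inE cY.
by apply/set0Pn; exists c.
Qed.

(** Two codewords closer than [2e + 1] would both be within [e] of the set
    obtained from [c1] by exchanging [e] of the points in which it differs from
    [c2], or all of them if there are fewer. *)
Lemma perfect_code_min_dist c1 c2 : c1 \in C -> c2 \in C -> c1 != c2 ->
  2 * e < #|c1 :\: c2|.
Proof.
move=> c1C c2C; apply: contra_neqT; rewrite -leqNgt => le_d.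
have w1 := code_wsubset c1C; have w2 := code_wsubset c2C.
have d21 : #|c2 :\: c1| = #|c1 :\: c2| by apply: card_setD_sym; rewrite w1 w2.
have [|A sA cA] := @exists_subset_card _ (c1 :\: c2) (minn e #|c1 :\: c2|).
  exact: geq_minr.
have [|B sB cB] := @exists_subset_card _ (c2 :\: c1) (minn e #|c1 :\: c2|).
  by rewrite d21 geq_minr.
have /subsetDP[sA1 dA2] := sA; have /subsetDP[sB2 dB1] := sB.
pose Y := c1 :\: A :|: B.
have cY : #|Y| = w.
  rewrite cardsU cardsD w1 (setIidPr sA1) cA cB.
  have -> : (c1 :\: A) :&: B = set0.
    by apply/eqP; rewrite setI_eq0 disjoint_sym (disjointWr _ dB1) ?subsetDl.
  have := subset_leq_card sA1; rewrite cards0 cA w1; lia.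
apply: (@perfect_code_uniq Y) => //; first by rewrite inE cY.
  have sd : c1 :\: Y \subset A.
    apply/subsetP => x; rewrite !inE.
    by case: (x \in A); case: (x \in c1); rewrite ?andbF.
  by apply: leq_trans (subset_leq_card sd) _; rewrite cA geq_minl.
have sd : c2 :\: Y \subset (c2 :\: c1) :\: B.
  apply/subsetP => x; rewrite !inE; case xA: (x \in A).
    have := subsetP sA x xA; rewrite !inE => /andP[/negPf-> _].
    by rewrite !andbF.
  by case: (x \in B); case: (x \in c1).
apply: leq_trans (subset_leq_card sd) _.
rewrite cardsD (setIidPr sB) cB d21; lia.
Qed.

(** [N] is the set of codewords at distance [2e + 1] from the codeword [X] that
    avoid [R] and contain [S].  Each point [p] of [P] lies in some [c \in N],
    the codeword covering [Q :|: (p |: S)], while each point of [Q] is missed by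
    at most one, two being too close otherwise.  Counting incidences in [P] and
    non-incidences in [Q] bounds [#|N|] on both sides. *)
Lemma Roos_bound : 0 < e -> 2 * w <= n -> 1 < #|C| ->
  e * (n - 2 * w) + (2 * e).+1 <= w.
Proof.
move=> e_gt0 le_n C_gt1.
have [X XC] : exists X, X \in C by apply/card_gt0P; apply: ltnW.
have cX := code_wsubset XC.
have le_w : 2 * e < w.
  have [c] : exists c, c \in C :\ X.
    by apply/card_gt0P; move: C_gt1; rewrite (cardsD1 X C) XC.
  rewrite 2!inE => /andP[cX' cC].
  have := perfect_code_min_dist cC XC cX'.
  by have := subset_leq_card (subsetDl c X); rewrite (code_wsubset cC); lia.
have cXc : #|~: X| = n - w by rewrite cardsCs setCK card_ord cX.
have [R sR cR] := @exists_subset_card _ X e.+1 ltac:(lia).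
have [S sS cS] := @exists_subset_card _ (~: X) e ltac:(lia).
pose N := [set c in C | [&& R \subset X :\: c, S \subset c &
                         #|X :\: c| == (2 * e).+1]].
pose P := ~: X :\: S; pose Q := X :\: R.
have cP : #|P| = n - w - e by rewrite cardsD (setIidPr sS) cXc cS.
have cQ : #|Q| = w - e.+1 by rewrite cardsD (setIidPr sR) cX cR.
have NP c : c \in N -> [/\ c \in C, R \subset X :\: c, S \subset c :\: X,
    #|X :\: c| = (2 * e).+1 & #|c :\: X| = (2 * e).+1].
  rewrite inE => /and4P[cC sRc sSc /eqP dXc]; split=> //.
    by rewrite subsetD sSc disjoints_subset sS.
  by rewrite -(@card_setD_sym _ X c) // cX code_wsubset.
have N_P c : c \in N -> #|c :&: P| = e.+1.
  case/NP=> _ _ sSc _ dcX.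
  have -> : c :&: P = (c :\: X) :\: S by rewrite /P !setDE setIA.
  by rewrite cardsD (setIidPr sSc) dcX cS; lia.
have N_Q c : c \in N -> #|Q :\: c| = e.
  case/NP=> _ sRc _ dXc _.
  have -> : Q :\: c = (X :\: c) :\: R by rewrite /Q !setDDl setUC.
  by rewrite cardsD (setIidPr sRc) dXc cR; lia.
have coverP p : p \in P -> exists2 c, c \in N & p \in c.
  rewrite !inE => /andP[pS pX].
  pose Y := Q :|: (p |: S).
  have dYX : [disjoint X & p |: S].
    rewrite disjoint_sym disjoints_subset subUset sub1set inE pX.
    exact: sS.
  have cY : #|Y| = w.
    rewrite cardsU cQ cardsU1 pS cS.
    have -> : Q :&: (p |: S) = set0.
      by apply/eqP; rewrite setI_eq0 (disjointWl _ dYX) // subsetDl.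
    by rewrite cards0; lia.
  have [c cC dcY] := @perfect_code_cover Y ltac:(by rewrite inE cY).
  have dYc : #|Y :\: c| <= e.
    by rewrite (@card_setD_sym _ Y c) // cY code_wsubset.
  have neq_cX : X != c.
    apply: contraTneq dcY => <-.
    rewrite -ltnNge /johnson_dist -cR subset_leq_card //.
    apply/subsetP => x xR; have xX := subsetP sR x xR.
    rewrite inE xX andbT inE negb_or (disjointFr dYX xX) andbT.
    by rewrite inE xR.
  have min_d := perfect_code_min_dist XC cC neq_cX.
  have sXc : X :\: c \subset R :|: (Y :\: c).
    apply/subsetP => x; rewrite !inE => /andP[-> ->].
    by case: (x \in R).
  have le_d : #|R :|: (Y :\: c)| <= (2 * e).+1.
    by apply: leq_trans (leq_card_setU _ _).1 _; rewrite cR; lia.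
  (* The minimum distance leaves no slack in [le_d], so [sXc] is an equality. *)
  have /eqP eqXc : X :\: c == R :|: (Y :\: c).
    by rewrite eqEcard sXc (leq_trans le_d).
  have sSc : p |: S \subset c.
    apply/subsetP => x xpS; apply: contraFT (disjointFl dYX xpS) => xc.
    have : x \in X :\: c.
      by rewrite eqXc !(inE, in_setU) -in_setU1 xpS xc /= !orbT.
    by rewrite inE => /andP[].
  have [pc sSc'] : p \in c /\ S \subset c.
    by apply/andP; rewrite -sub1set -subUset.
  exists c; rewrite // inE cC eqXc subsetUl sSc' eqn_leq le_d.
  by rewrite -eqXc min_d.
have uniqQ r c1 c2 : r \in Q -> c1 \in N -> c2 \in N ->
    r \notin c1 -> r \notin c2 -> c1 = c2.
  rewrite inE => /andP[rR rX].
  move=> /NP[c1C sR1 sS1 dX1 d1X] /NP[c2C sR2 sS2 dX2 d2X] r1 r2.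
  apply/eqP; apply/negPn/negP => /(perfect_code_min_dist c1C c2C).
  apply/negP; rewrite -leqNgt.
  have sc12 :
      c1 :\: c2 \subset ((X :\: c2) :\: (r |: R)) :|: ((c1 :\: X) :\: S).
    apply/subsetP => x; rewrite inE => /andP[xc2 xc1].
    have xR : x \notin R.
      by apply: contraL xc1 => /(subsetP sR1); rewrite inE => /andP[].
    have xS : x \notin S.
      by apply: contra xc2 => /(subsetP sS2); rewrite inE => /andP[].
    have xr : x != r by apply: contraNneq r1 => <-.
    rewrite !inE xc2 xc1 (negPf xR) (negPf xS) (negPf xr).
    by case: (x \in X).
  apply: leq_trans (subset_leq_card sc12) _.
  apply: leq_trans (leq_card_setU _ _).1 _.
  rewrite (cardsD _ (r |: R)) (cardsD _ S) dX2 d1X (setIidPr sS1) cS.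
  have /setIidPr -> : r |: R \subset X :\: c2.
    by rewrite subUset sub1set inE r2 rX.
  by rewrite cardsU1 rR cR add1n; clear -e_gt0; lia.
have leP : n - w - e <= #|N| * e.+1.
  rewrite -cP -sum_nat_const -(eq_bigr _ N_P).
  under eq_bigr => c _ do rewrite -sum1_card.
  rewrite (exchange_big_dep (mem P)) /=; last first.
    by move=> c p _; rewrite inE => /andP[].
  rewrite -sum1_card; apply: leq_sum => p pP.
  have [c cN pc] := coverP p pP.
  by rewrite (bigD1 c) //= cN inE pc.
have leQ : #|N| * e <= w - e.+1.
  rewrite -cQ -sum_nat_const -(eq_bigr _ N_Q).
  under eq_bigr => c _ do rewrite -sum1_card.
  rewrite (exchange_big_dep (mem Q)) /=; last first.
    by move=> c p _; rewrite inE => /andP[].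
  rewrite -[leqRHS]sum1_card; apply: leq_sum => r rQ.
  rewrite sum1_card; apply/card_le1_eqP => c1 c2.
  move=> /andP[c1N]; rewrite inE => /andP[rc1 _].
  by move=> /andP[c2N]; rewrite inE => /andP[rc2 _]; apply: (uniqQ r).
have : e * (n - w - e) <= e.+1 * (w - e.+1).
  apply: (@leq_trans (e * (#|N| * e.+1))).
    by rewrite leq_mul2l leP orbT.
  by rewrite mulnA mulnC leq_mul2l (mulnC e) leQ.
have -> : n - w - e = (n - 2 * w) + (w - e.+1) + 1 by lia.
rewrite !mulnDr mulSn; lia.
Qed.

(** * Divisibility at the strength *)

Definition code_excess X : int := ((Phi e n w * (X \in C))%:Z - 1)%R.

Lemma sum_code_excess (P : pred {set 'I_n}) :
  (\sum_(X in V | P X) code_excess X =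
   (Phi e n w * #|[set X in C | P X]|)%:Z - #|[set X in V | P X]|%:Z)%R.
Proof.
case: perfC => /subsetP sC _ _.
rewrite sumrB; congr (_ - _)%R; last first.
  rewrite sumr_const -mulr_natl mulr1 natz; congr Posz.
  by apply: eq_card => X; rewrite inE.
rewrite -(big_morph Posz PoszD (erefl _)) -big_distrr /=; congr (Posz (_ * _)).
rewrite -sum1_card -big_mkcondr /=; apply: eq_bigl => X; rewrite [RHS]inE.
by case XC: (X \in C); rewrite ?andbF // andbT sC.
Qed.

Lemma code_excess_ball_sum0 Y : e <= w -> Y \in V ->
  (\sum_(X in V | (johnson_dist X Y <= e)%N) code_excess X = 0)%R.
Proof.
move=> le_ew YV; rewrite sum_code_excess; apply/eqP; rewrite subr_eq0 eqz_nat.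
have -> : #|[set X in C | johnson_dist X Y <= e]| = 1.
  have [c cC dc] := perfect_code_cover YV.
  apply/eqP/cards1P; exists c; apply/setP => X; rewrite !inE.
  apply/andP/eqP => [[XC dX]|->//].
  exact: (perfect_code_uniq YV).
have -> : [set X in V | johnson_dist X Y <= e] =
          [set X | (X \in V) && (X :&: set0 == set0) & johnson_dist Y X <= e].
  apply/setP => X; rewrite [LHS]inE [RHS]inE setI0 eqxx andbT.
  by case XV: (X \in V); rewrite //= (johnson_distC XV YV).
rewrite card_le_fibers muln1 /Phi big_mkord; apply/eqP/eq_bigr => i _.
have le_iw : i <= w by have := ltn_ord i; lia.
have := @card_johnson_sphere_avoiding n w Y set0 i YV.
move=> /(_ ltac:(by rewrite cards0) le_iw).
rewrite setI0 cards0 !subn0 addn0 bin_sub // => <-.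
by apply: eq_card => X; rewrite !inE andbA.
Qed.

Lemma card_code_trace t T S : traces_vanish w code_excess t ->
    #|T| <= t -> S \subset T -> #|S| <= w ->
  Phi e n w * #|[set X in C | X :&: T == S]| = 'C(n - #|T|, w - #|S|).
Proof.
move=> vt le_T sST le_S; have := vt T S le_T.
rewrite /trace_sum sum_code_excess card_wsubsets_trace // => /eqP.
by rewrite subr_eq0 eqz_nat => /eqP.
Qed.

Lemma Phi_gt0 : 0 < Phi e n w.
Proof. by rewrite /Phi big_nat_recl // !bin0. Qed.

Lemma traces_vanish_design t :
  t <= w -> traces_vanish w code_excess t -> is_design t C.
Proof.
move=> le_tw vt; exists ('C(n - t, w - t) %/ Phi e n w) => T cT.
have <- : Phi e n w * #|[set X in C | X :&: T == T]| = 'C(n - t, w - t).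
  by rewrite (card_code_trace vt) ?cT.
rewrite mulKn ?Phi_gt0 //.
by apply: eq_card => X; rewrite !inE setI_eqr.
Qed.

Lemma design_traces_vanish t : t <= w <= n ->
  traces_vanish w code_excess 0 -> is_design t C ->
  traces_vanish w code_excess t.
Proof.
move=> /[dup] /andP[le_tw _] le_twn v0 [lambda des].
apply: traces_vanish_const => // T T' cT cT'.
have tr_des (U : {set 'I_n}) : #|U| = t -> trace_sum w code_excess U U =
    ((Phi e n w * lambda)%:Z - 'C(n - t, w - t)%:Z)%R.
  move=> cU; rewrite /trace_sum sum_code_excess card_wsubsets_trace ?cU //.
  rewrite -(des U cU); congr (Posz (_ * _) - _)%R.
  by apply: eq_card => X; rewrite !inE setI_eqr.
by rewrite !tr_des.
Qed.

(** ['C(n - t, w - s)] is [Phi] times the number of codewords with a given trace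
    of size [s] on a [t]-set. *)
Lemma Phi_dvd_bin t s : s <= t <= w -> w <= n ->
  traces_vanish w code_excess t -> Phi e n w %| 'C(n - t, w - s).
Proof.
move=> /andP[le_st le_tw] le_wn vt.
have [|T _ cT] := @exists_subset_card _ [set: 'I_n] t.
  by rewrite cardsT card_ord; lia.
have [|S sS cS] := @exists_subset_card _ T s; first by rewrite cT.
rewrite -cT -cS -(card_code_trace vt) ?cT ?cS ?dvdn_mulr //; lia.
Qed.
End PerfectCodes.

Theorem corollary5p2 (n w e d : nat) (C : {set {set 'I_n}})
    (hw : 2 <= 2 * w) (hn : 2 * w <= n) (he : 1 <= e)
    (hC : perfect_code w e C) (hnt : ~ trivial_code w e C)
    (hd : is_strength_redundancy w C d) :
  Phi e n w %| \big[gcdn/0]_(d <= k < (n - w).+1) 'C(n - w + d, k).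
Proof.
case: hd => phi [le_phi des_phi max_phi] def_d.
have le_wn : w <= n by lia.
have roos : e * (n - 2 * w) + (2 * e).+1 <= w.
  apply: (Roos_bound hC) => //; rewrite ltn_neqAle card_gt0.
  rewrite (perfect_code_neq0 hC) // andbT eq_sym.
  by apply/eqP => C1; apply: hnt; constructor 2.
have le_ew : e <= w.
  by apply: leq_trans (leq_trans (leq_addl _ _) roos); lia.
set a := n - 2 * w in roos.
have lt_aw : a < w by have : a <= e * a; [exact: leq_pmull | lia].
have small t : t <= a.-1 -> traces_vanish w (code_excess w e C) t.
  move=> le_t; apply: (@traces_vanish_small n w _ e) => // Y YV.
  exact: code_excess_ball_sum0.
have le_a_phi : a.-1 <= phi.
  apply: max_phi; first by lia.
  by apply: (traces_vanish_design hC (e := e)); [lia | exact: small].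
have vphi : traces_vanish w (code_excess w e C) phi.
  by apply: design_traces_vanish; rewrite ?le_phi //; apply: small.
have dvd_bin s : s <= phi -> Phi e n w %| 'C(n - phi, w - s).
  by move=> le_s; apply: (Phi_dvd_bin hC) => //; rewrite le_s.
have -> : n - w + d = n - phi by lia.
rewrite big_nat_cond; elim/big_ind: _ => [|x y dx dy|k]; first exact: dvdn0.
  by rewrite dvdn_gcd dx.
rewrite andbT ltnS => /andP[le_dk le_k].
have [le_kw|lt_wk] := leqP k w.
  by have := dvd_bin (w - k); rewrite subKn //; apply; lia.
(* Here [n - phi - k <= w], because [phi >= a - 1]. *)
rewrite -bin_sub; last by lia.
have := dvd_bin (w - (n - phi - k)); rewrite subKn; last by lia.
by apply; lia.
Qed.
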